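(* Let $G$ be an equationally Noetherian group. If $Y$ is a non-empty algebraic subset of $G^n$, then the Zariski dimension of $Y$ is equal to the Krull dimension $Kdim_G(\Gamma(Y))$ of its coordinate group $\Gamma(Y)$.
   Context: Let $G$ be a group, $X = \{x_1,\ldots,x_n\}$, $F(X)$ the free group on $X$, and $G[X] = G * F(X)$. For $s \in G[X]$ and $(g_1,\ldots,g_n)\in G^n$, $s(g_1,\ldots,g_n)\in G$ is obtained by replacing each $x_j$ by $g_j$. For $S \subseteq G[X]$ put $V_G(S) = \{g \in G^n \mid s(g) = 1 \text{ for all } s\in S\}$; such sets are the algebraic subsets of $G^n$. $G$ is equationally Noetherian if for every finite $X$ and every $S\subseteq G[X]$ there is a finite $S_0\subseteq S$ with $V_G(S)=V_G(S_0)$. The Zariski topology on $G^n$ is the topology having the algebraic sets as a pre-basis (subbasis) of closed sets; it is Noetherian when $G$ is equationally Noetherian. A closed subset is irreducible if it is not a union of two closed proper subsets. The Zariski dimension of $Y$ (with the induced topology) is the supremum of the $k$ for which there is a chain $Z_0\subset Z_1\subset\cdots\subset Z_k$ of distinct irreducible non-empty closed subsets of $Y$. For an algebraic set $Y\subseteq G^n$, $I(Y) = \{f\in G[X] \mid f(a)=1 \text{ for all } a \in Y\}$ and $\Gamma(Y) = G[X]/I(Y)$ is the coordinate group of $Y$; if $Y\neq\emptyset$, $G$ embeds canonically into $\Gamma(Y)$, which is thereby a $G$-group. A $G$-group is a group with a distinguished subgroup identified with $G$; a $G$-homomorphism is a homomorphism of $G$-groups that is the identity on $G$. A $G$-group $H$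 is $G$-discriminated by $G$ if for every finite $K\subseteq H$ there is a $G$-homomorphism $H\to G$ injective on $K$. An ideal of a $G$-group $H$ is a normal subgroup $N$ of $H$ with $N\cap G=1$; it is prime if $H/N$, as a $G$-group, is $G$-discriminated by $G$. $Kdim_G(H)$ is the supremum of the $k$ for which there is a chain $p_0\subset p_1\subset\cdots\subset p_k$ of distinct prime ideals of $H$. *)

(* Defs.v *)
From HB Require Import structures.
From mathcomp Require Import all_boot all_order ssralg ssrnum ssrint.
From mathcomp Require Import all_classical constructive_ereal.
From mathcomp Require Import topology_structure subtype_topology.

Set Implicit Arguments.
Unset Strict Implicit.
Unset Printing Implicit Defensive.

Local Open Scope classical_set_scope.
Local Open Scope quotient_scope.
Local Open Scope group_scope.

Lemma multiplicative1 (G H : groupType) (f : {multiplicative G -> H}) : f 1 = 1.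
Proof. by apply: (mulgI (f 1)); rewrite -gmulfM !mulg1. Qed.

(* The least congruence on the free monoid [seq A] containing [R]. *)
Inductive word_congr (A : Type) (R : seq A -> seq A -> Prop) :
    seq A -> seq A -> Prop :=
| WordRel u v s t of R s t : word_congr R (u ++ s ++ v) (u ++ t ++ v)
| WordRefl s : word_congr R s s
| WordSym s t of word_congr R s t : word_congr R t s
| WordTrans s t u of word_congr R s t & word_congr R t u : word_congr R s u.

(* A monoid presentation in which every letter has an inverse letter. *)
Record presentation := Presentation {
  letter : choiceType;
  relator : seq letter -> seq letter -> Prop;
  letter_inv : letter -> letter;
  letter_invr : forall a, word_congr relator [:: a; letter_inv a] [::];
  letter_invl : forall a, word_congr relator [:: letter_inv a; a] [::]
}.

Section PresentedGroup.
Variable P : presentation.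
Implicit Types s t u : seq (letter P).

Definition word_eqb s t : bool := `[< word_congr (@relator P) s t >].

Lemma word_eqb_refl : reflexive word_eqb.
Proof. by move=> s; apply/asboolP; exact: WordRefl. Qed.

Lemma word_eqb_sym : symmetric word_eqb.
Proof. by move=> s t; apply/asboolP/asboolP; exact: WordSym. Qed.

Lemma word_eqb_trans : transitive word_eqb.
Proof.
move=> t s u /asboolP st /asboolP tu; apply/asboolP; exact: WordTrans st tu.
Qed.

Canonical word_equiv :=
  EquivRel word_eqb word_eqb_refl word_eqb_sym word_eqb_trans.

Definition presented := {eq_quot word_equiv}.
HB.instance Definition _ := Choice.on presented.
HB.instance Definition _ := EqQuotient.on presented.

Lemma presented_piP s t :
  word_congr (@relator P) s t <-> \pi_presented s = \pi_presented t.
Proof.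
split=> [st|/eqP]; last by rewrite piE => /asboolP.
by apply/eqP; rewrite piE; apply/asboolP.
Qed.

Lemma word_congr_ctx u v s t : word_congr (@relator P) s t ->
  word_congr (@relator P) (u ++ s ++ v) (u ++ t ++ v).
Proof.
elim=> {s t} [u' v' s t st|s|s t _|s t w _ st _].
- by have := WordRel (u ++ u') (v' ++ v) st; rewrite -!catA.
- exact: WordRefl.
- exact: WordSym.
- exact: WordTrans.
Qed.

Lemma word_congr_cat s s' t t' :
  word_congr (@relator P) s s' -> word_congr (@relator P) t t' ->
  word_congr (@relator P) (s ++ t) (s' ++ t').
Proof.
move=> ss' tt'; apply: (@WordTrans _ _ _ (s' ++ t)).
  exact: (word_congr_ctx [::] t ss').
by have := word_congr_ctx s' [::] tt'; rewrite !cats0.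
Qed.

Definition presented_one : presented := \pi_presented [::].
Definition presented_mul (x y : presented) : presented :=
  \pi_presented (repr x ++ repr y).
Definition presented_inv (x : presented) : presented :=
  \pi_presented (rev (map (@letter_inv P) (repr x))).

Lemma presented_pi_mul s t :
  presented_mul (\pi s) (\pi t) = \pi_presented (s ++ t).
Proof.
by apply/presented_piP/word_congr_cat; apply/presented_piP; rewrite reprK.
Qed.

Lemma presented_mulA : associative presented_mul.
Proof.
move=> x y z; rewrite -[x]reprK -[y]reprK -[z]reprK.
by rewrite !presented_pi_mul catA.
Qed.

Lemma presented_mul1 : left_id presented_one presented_mul.
Proof. by move=> x; rewrite -[x]reprK presented_pi_mul. Qed.

Lemma presented_1mul : right_id presented_one presented_mul.
Proof. by move=> x; rewrite -[x]reprK presented_pi_mul cats0. Qed.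

Lemma presented_mulV : right_inverse presented_one presented_inv presented_mul.
Proof.
move=> x; rewrite -[X in presented_mul X _]reprK presented_pi_mul.
apply/presented_piP; elim: (repr x) => [|a s IH] /=; first exact: WordRefl.
rewrite rev_cons -cats1 catA -cat1s -!catA.
apply: WordTrans (letter_invr a).
have := word_congr_ctx [:: a] [:: letter_inv a] IH.
by rewrite -!catA.
Qed.

Lemma presented_Vmul : left_inverse presented_one presented_inv presented_mul.
Proof.
move=> x; rewrite -[X in presented_mul _ X]reprK presented_pi_mul.
apply/presented_piP; elim: (repr x) => [|a s IH] /=; first exact: WordRefl.
rewrite rev_cons -cats1 -catA.
apply: WordTrans IH.
exact: (word_congr_ctx _ s (letter_invl a)).
Qed.

HB.instance Definition _ := isGroup.Build presented presented_mulA
  presented_mul1 presented_1mul presented_Vmul presented_mulV.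

Lemma presented_piM s t :
  \pi_presented (s ++ t) = \pi_presented s * \pi_presented t.
Proof. by rewrite -presented_pi_mul. Qed.

Variables (K : groupType) (f : letter P -> K).

(* Meaningful when [f] respects the relations: see [presented_evalM]. *)
Definition presented_eval (x : presented) : K := \prod_(a <- repr x) f a.

Hypothesis f_rel : forall s t,
  relator s t -> \prod_(a <- s) f a = \prod_(a <- t) f a.

Lemma word_congr_prod s t : word_congr (@relator P) s t ->
  \prod_(a <- s) f a = \prod_(a <- t) f a.
Proof.
elim=> {s t} [u v s t st|//|s t _ ->//|s t u _ -> _ ->//].
by rewrite !big_cat /= (f_rel st).
Qed.

Lemma presented_eval_pi s : presented_eval (\pi s) = \prod_(a <- s) f a.
Proof. by apply/word_congr_prod/presented_piP; rewrite reprK. Qed.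

Lemma presented_evalM : {morph presented_eval : x y / x * y}.
Proof.
move=> x y; rewrite -[x]reprK -[y]reprK -presented_piM.
by rewrite !presented_eval_pi big_cat.
Qed.

End PresentedGroup.

Section FreeGroup.
Variable X : choiceType.

(* The letter [(x, true)] is x and [(x, false)] is its inverse. *)
Inductive free_rel : seq (X * bool) -> seq (X * bool) -> Prop :=
| FreeCancel x b : free_rel [:: (x, b); (x, ~~ b)] [::].

Definition free_letter_inv (a : X * bool) : X * bool := (a.1, ~~ a.2).

Lemma free_letter_invr a : word_congr free_rel [:: a; free_letter_inv a] [::].
Proof. by case: a => x b; exact: (WordRel [::] [::] (FreeCancel x b)). Qed.

Lemma free_letter_invl a : word_congr free_rel [:: free_letter_inv a; a] [::].
Proof.
by case: a => x b; have := free_letter_invr (x, ~~ b);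
  rewrite /free_letter_inv /= negbK.
Qed.

Definition free_presentation := Presentation free_letter_invr free_letter_invl.

Definition freegroup : groupType := presented free_presentation.

Definition free_gen (x : X) : freegroup :=
  \pi_(presented free_presentation) [:: (x, true)].

Variables (K : groupType) (f : X -> K).

Definition free_letter_val (a : X * bool) : K :=
  if a.2 then f a.1 else (f a.1)^-1.

Definition free_lift : freegroup -> K :=
  @presented_eval free_presentation K free_letter_val.

Lemma free_lift_rel s t : free_rel s t ->
  \prod_(a <- s) free_letter_val a = \prod_(a <- t) free_letter_val a.
Proof.
case=> x b; rewrite !big_cons !big_nil mulg1 /free_letter_val /=.
by case: b => /=; rewrite ?mulgV ?mulVg.
Qed.

Lemma free_lift_pi s : free_lift (\pi_(presented free_presentation) s) =
  \prod_(a <- s) free_letter_val a.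
Proof.
exact: (@presented_eval_pi free_presentation _ _ free_lift_rel).
Qed.

Lemma free_liftM : {morph free_lift : x y / x * y}.
Proof.
exact: (@presented_evalM free_presentation _ _ free_lift_rel).
Qed.

HB.instance Definition _ :=
  isMultiplicative.Build freegroup K free_lift free_liftM.

Lemma free_lift_gen x : free_lift (free_gen x) = f x.
Proof. by rewrite free_lift_pi big_seq1. Qed.

Lemma free_lift_uniq (h : {multiplicative freegroup -> K}) :
  (forall x, h (free_gen x) = f x) -> h =1 free_lift.
Proof.
move=> hf; have h1 := multiplicative1 h.
move=> x; rewrite -[x]reprK free_lift_pi.
elim: (repr x) => [|[y b] s IH]; first by rewrite big_nil -[RHS]h1.
rewrite -cat1s presented_piM gmulfM IH big_cat big_seq1 /=; congr (_ * _).
case: b => /=; first exact: hf.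
apply: (mulgI (h (free_gen y))).
rewrite -gmulfM -presented_piM [X in _ = X * _]hf mulgV -[RHS]h1.
congr (h _); apply/presented_piP.
exact: (WordRel [::] [::] (FreeCancel y true)).
Qed.

End FreeGroup.

Section FreeProduct.
Variables G H : groupType.

Inductive freeprod_rel : seq (G + H) -> seq (G + H) -> Prop :=
| FreeProd1l : freeprod_rel [:: inl 1] [::]
| FreeProd1r : freeprod_rel [:: inr 1] [::]
| FreeProdMl a b : freeprod_rel [:: inl a; inl b] [:: inl (a * b)]
| FreeProdMr a b : freeprod_rel [:: inr a; inr b] [:: inr (a * b)].

Definition freeprod_letter_inv (a : G + H) : G + H :=
  match a with inl g => inl g^-1 | inr h => inr h^-1 end.

Lemma freeprod_letter_invr a :
  word_congr freeprod_rel [:: a; freeprod_letter_inv a] [::].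
Proof.
case: a => a /=.
  apply: WordTrans (WordRel [::] [::] (FreeProdMl a a^-1)) _.
  by rewrite mulgV; exact: (WordRel [::] [::] FreeProd1l).
apply: WordTrans (WordRel [::] [::] (FreeProdMr a a^-1)) _.
by rewrite mulgV; exact: (WordRel [::] [::] FreeProd1r).
Qed.

Lemma freeprod_letter_invl a :
  word_congr freeprod_rel [:: freeprod_letter_inv a; a] [::].
Proof.
by have := freeprod_letter_invr (freeprod_letter_inv a);
  case: a => a /=; rewrite invgK.
Qed.

Definition freeprod_presentation :=
  Presentation freeprod_letter_invr freeprod_letter_invl.

Definition freeprod : groupType := presented freeprod_presentation.

Definition freeprod_inl (g : G) : freeprod :=
  \pi_(presented freeprod_presentation) [:: inl g].
Definition freeprod_inr (h : H) : freeprod :=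
  \pi_(presented freeprod_presentation) [:: inr h].

Lemma freeprod_inlM : {morph freeprod_inl : x y / x * y}.
Proof.
move=> x y; rewrite -presented_piM; apply/presented_piP/WordSym.
exact: (WordRel [::] [::] (FreeProdMl x y)).
Qed.

Lemma freeprod_inrM : {morph freeprod_inr : x y / x * y}.
Proof.
move=> x y; rewrite -presented_piM; apply/presented_piP/WordSym.
exact: (WordRel [::] [::] (FreeProdMr x y)).
Qed.

HB.instance Definition _ :=
  isMultiplicative.Build G freeprod freeprod_inl freeprod_inlM.
HB.instance Definition _ :=
  isMultiplicative.Build H freeprod freeprod_inr freeprod_inrM.

Variables (K : groupType).
Variables (f : {multiplicative G -> K}) (h : {multiplicative H -> K}).

Definition freeprod_letter_val (a : G + H) : K :=
  match a with inl x => f x | inr y => h y end.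

Definition freeprod_lift : freeprod -> K :=
  @presented_eval freeprod_presentation K freeprod_letter_val.

Lemma freeprod_lift_rel s t : freeprod_rel s t ->
  \prod_(a <- s) freeprod_letter_val a = \prod_(a <- t) freeprod_letter_val a.
Proof.
case=> [||a b|a b]; rewrite !big_cons !big_nil !mulg1 /= ?gmulfM //.
  exact: multiplicative1.
exact: multiplicative1.
Qed.

Lemma freeprod_lift_pi s :
  freeprod_lift (\pi_(presented freeprod_presentation) s) =
  \prod_(a <- s) freeprod_letter_val a.
Proof.
exact: (@presented_eval_pi freeprod_presentation _ _ freeprod_lift_rel).
Qed.

Lemma freeprod_liftM : {morph freeprod_lift : x y / x * y}.
Proof.
exact: (@presented_evalM freeprod_presentation _ _ freeprod_lift_rel).
Qed.

HB.instance Definition _ :=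
  isMultiplicative.Build freeprod K freeprod_lift freeprod_liftM.

Lemma freeprod_lift_inl g : freeprod_lift (freeprod_inl g) = f g.
Proof. by rewrite freeprod_lift_pi big_seq1. Qed.

Lemma freeprod_lift_inr x : freeprod_lift (freeprod_inr x) = h x.
Proof. by rewrite freeprod_lift_pi big_seq1. Qed.

Lemma freeprod_lift_uniq (k : {multiplicative freeprod -> K}) :
  (forall g, k (freeprod_inl g) = f g) ->
  (forall x, k (freeprod_inr x) = h x) ->
  k =1 freeprod_lift.
Proof.
move=> kf kh; have k1 := multiplicative1 k.
move=> x; rewrite -[x]reprK freeprod_lift_pi.
elim: (repr x) => [|a s IH]; first by rewrite big_nil -[RHS]k1.
rewrite -cat1s presented_piM gmulfM IH big_cat big_seq1 /=; congr (_ * _).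
by case: a => a; [exact: kf | exact: kh].
Qed.

End FreeProduct.

Record normal_subgroup (H : groupType) := NormalSubgroup {
  normal_set :> set H;
  normal1 : normal_set 1;
  normalM : forall x y, normal_set x -> normal_set y -> normal_set (x * y);
  normalV : forall x, normal_set x -> normal_set x^-1;
  normalJ : forall x y, normal_set x -> normal_set (x ^ y)
}.

Section Quotient.
Variables (H : groupType) (N : normal_subgroup H).

Definition coset_eqb (x y : H) : bool := `[< normal_set N (x^-1 * y) >].

Lemma coset_eqb_refl : reflexive coset_eqb.
Proof. by move=> x; apply/asboolP; rewrite mulVg; exact: normal1. Qed.

Lemma coset_eqb_sym : symmetric coset_eqb.
Proof.
move=> x y; apply/asboolP/asboolP=> /normalV; by rewrite invgM invgK.
Qed.

Lemma coset_eqb_trans : transitive coset_eqb.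
Proof.
move=> y x z /asboolP xy /asboolP yz; apply/asboolP.
by have := normalM xy yz; rewrite -mulgA mulVKg.
Qed.

Canonical coset_equiv :=
  EquivRel coset_eqb coset_eqb_refl coset_eqb_sym coset_eqb_trans.

Definition quotient_group := {eq_quot coset_equiv}.
HB.instance Definition _ := Choice.on quotient_group.
HB.instance Definition _ := EqQuotient.on quotient_group.

Lemma quotient_piP x y :
  normal_set N (x^-1 * y) <-> \pi_quotient_group x = \pi_quotient_group y.
Proof.
split=> [xy|/eqP]; last by rewrite piE => /asboolP.
by apply/eqP; rewrite piE; apply/asboolP.
Qed.

Definition quotient_one : quotient_group := \pi_quotient_group 1.
Definition quotient_mul (x y : quotient_group) : quotient_group :=
  \pi_quotient_group (repr x * repr y).
Definition quotient_inv (x : quotient_group) : quotient_group :=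
  \pi_quotient_group (repr x)^-1.

Lemma quotient_pi_mul x y :
  quotient_mul (\pi x) (\pi y) = \pi_quotient_group (x * y).
Proof.
set x' := repr (\pi_quotient_group x); set y' := repr (\pi_quotient_group y).
have Nx : normal_set N (x'^-1 * x) by apply/quotient_piP; rewrite reprK.
have Ny : normal_set N (y'^-1 * y) by apply/quotient_piP; rewrite reprK.
apply/quotient_piP.
have := normalM Ny (normalJ y Nx).
by rewrite conjgE invgM !mulgA mulgK.
Qed.

Lemma quotient_mulA : associative quotient_mul.
Proof.
move=> x y z; rewrite -[x]reprK -[y]reprK -[z]reprK.
by rewrite !quotient_pi_mul mulgA.
Qed.

Lemma quotient_1mul : left_id quotient_one quotient_mul.
Proof. by move=> x; rewrite -[x]reprK quotient_pi_mul mul1g. Qed.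

Lemma quotient_mul1 : right_id quotient_one quotient_mul.
Proof. by move=> x; rewrite -[x]reprK quotient_pi_mul mulg1. Qed.

Lemma quotient_Vmul : left_inverse quotient_one quotient_inv quotient_mul.
Proof.
by move=> x; rewrite -[X in quotient_mul _ X]reprK quotient_pi_mul mulVg.
Qed.

Lemma quotient_mulV : right_inverse quotient_one quotient_inv quotient_mul.
Proof.
by move=> x; rewrite -[X in quotient_mul X _]reprK quotient_pi_mul mulgV.
Qed.

HB.instance Definition _ := isGroup.Build quotient_group quotient_mulA
  quotient_1mul quotient_mul1 quotient_Vmul quotient_mulV.

Definition quotient_proj (x : H) : quotient_group := \pi_quotient_group x.

Lemma quotient_projM : {morph quotient_proj : x y / x * y}.
Proof. by move=> x y; rewrite /quotient_proj -quotient_pi_mul. Qed.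

HB.instance Definition _ :=
  isMultiplicative.Build H quotient_group quotient_proj quotient_projM.

End Quotient.

Record ggroup (G : groupType) := GGroup {
  ggroup_sort :> groupType;
  gincl : {multiplicative G -> ggroup_sort};
  gincl_inj : injective gincl
}.
Arguments gincl {G} H : rename.
Arguments gincl_inj {G} H : rename.

Definition base_ggroup (G : groupType) : ggroup G :=
  @GGroup G G (idfun : {multiplicative G -> G}) (fun x y xy => xy).

Definition is_ghom (G : groupType) (H K : ggroup G)
    (f : {multiplicative H -> K}) : Prop :=
  forall g : G, f (gincl H g) = gincl K g.

Definition discriminated (G : groupType) (H : ggroup G) : Prop :=
  forall K : set H, finite_set K ->
    exists2 f : {multiplicative H -> base_ggroup G}, is_ghom f & set_inj K f.

Record ideal (G : groupType) (H : ggroup G) := Ideal {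
  ideal_normal :> normal_subgroup H;
  ideal_cap : ideal_normal `&` range (gincl H) = [set 1]
}.

Section QuotientGGroup.
Variables (G : groupType) (H : ggroup G) (N : ideal H).

Definition quotient_gincl : G -> quotient_group N := quotient_proj N \o gincl H.

HB.instance Definition _ := Multiplicative.on quotient_gincl.

Lemma quotient_gincl_inj : injective quotient_gincl.
Proof.
move=> x y /quotient_piP Nxy; apply: (gincl_inj H).
apply: (mulgI (gincl H x)^-1); rewrite mulVg; apply/esym.
suff : [set 1] ((gincl H x)^-1 * gincl H y) by [].
rewrite -(ideal_cap N); split => //; exists (x^-1 * y) => //.
apply: (mulgI (gincl H x)); rewrite -gmulfM !mulgA !mulgV !mul1g //.
Qed.

Definition quotient_ggroup : ggroup G :=
  @GGroup G (quotient_group N) quotient_gincl quotient_gincl_inj.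

End QuotientGGroup.

Definition is_prime (G : groupType) (H : ggroup G) (p : set H) : Prop :=
  exists2 N : ideal H, N = p :> set H & discriminated (quotient_ggroup N).

(* [A_0, ..., A_k] satisfy [P] and increase strictly; the values of [A] beyond
   [k] are irrelevant. *)
Definition has_chain (T : Type) (P : set (set T)) (k : nat) : Prop :=
  exists A : nat -> set T, (forall i, (i <= k)%N -> P (A i)) /\
    (forall i, (i < k)%N -> A i `<` A i.+1).

Definition chain_dim (T : Type) (P : set (set T)) : \bar int :=
  supremum -oo%E [set (k%:Z)%:E | k in has_chain P].

(* Suprema of sets of naturals always exist in [\bar int], so the junk value of
   [supremum] is never used. *)
Lemma chain_dimP (T : Type) (P : set (set T)) :
  supremums [set (k%:Z)%:E | k in has_chain P] (chain_dim P).
Proof.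
set D := [set _ | _ in _]; rewrite /chain_dim -/D /supremum.
suff [x Dx] : supremums D !=set0.
  case: ifPn => [/eqP D0|_]; last exact: (xgetPex _ (ex_intro _ x Dx)).
  by rewrite D0; split=> [? []|? _]; exact: leNye.
have [[m Dm]|unb] := pselect (exists m, forall k, has_chain P k -> (k <= m)%N).
  have [[k0 Dk0]|D0] := pselect (exists k, has_chain P k); last first.
    exists -oo%E; split=> [? [k Pk]|? _]; last exact: leNye.
    by case: D0; exists k.
  have exD : exists k, `[< has_chain P k >] by exists k0; apply/asboolP.
  have ubD k : `[< has_chain P k >] -> (k <= m)%N by move=> /asboolP /Dm.
  case: (ex_maxnP exD ubD) => M /asboolP PM maxM.
  exists (M%:Z)%:E; split=> [_ [k Pk <-]|y]; last by apply; exists M.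
  by rewrite lee_fin lez_nat maxM//; apply/asboolP.
exists +oo%E; split=> [? _|y yub]; first exact: leey.
case: y yub => [z|//|] yub; last first.
  case: unb; exists 0 => k Pk.
  by have := yub _ (ex_intro2 _ _ k Pk erefl); rewrite leeNy_eq.
case: unb; exists `|z|%N => k Pk.
have := yub _ (ex_intro2 _ _ k Pk erefl); rewrite lee_fin => kz.
rewrite -[(k <= _)%N]lez_nat abszE (Order.POrderTheory.le_trans kz)//.
exact: Num.Theory.ler_norm.
Qed.

Definition krull_dim (G : groupType) (H : ggroup G) : \bar int :=
  chain_dim [set p : set H | is_prime p].

Definition irreducible_closed (T : topologicalType) (Z : set T) : Prop :=
  closed Z /\ ~ (exists A B : set T,
    [/\ closed A, closed B, A `<` Z, B `<` Z & Z = A `|` B]).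

Definition topological_dim (T : topologicalType) : \bar int :=
  chain_dim [set Z : set T | irreducible_closed Z /\ Z !=set0].

Section Zariski.
Variables (G : groupType) (n : nat).

(* G[X] = G * F(X) for X = {x_0, ..., x_(n-1)} *)
Definition gword : groupType := freeprod G (freegroup 'I_n).

Lemma gword_incl_inj : injective (@freeprod_inl G (freegroup 'I_n)).
Proof.
pose one1 : freegroup 'I_n -> G := free_lift (fun=> 1).
move=> x y /(congr1 (freeprod_lift idfun one1)).
by rewrite !freeprod_lift_inl.
Qed.

Definition gword_ggroup : ggroup G :=
  @GGroup G gword (@freeprod_inl G (freegroup 'I_n)) gword_incl_inj.

(* s(a_0, ..., a_(n-1)) *)
Definition subst (a : {ffun 'I_n -> G}) : gword -> G :=
  freeprod_lift idfun (free_lift a).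

Lemma substM a : {morph subst a : s t / s * t}.
Proof. exact: freeprod_liftM. Qed.

HB.instance Definition _ a :=
  isMultiplicative.Build gword G (subst a) (@substM a).

(* G^n with the Zariski topology *)
Definition affine : Type := {ffun 'I_n -> G}.
HB.instance Definition _ := Choice.on affine.

Definition zero_set (S : set gword) : set affine :=
  [set a | forall s, S s -> subst a s = 1].

Definition algebraic (Y : set affine) : Prop := exists S, Y = zero_set S.

HB.instance Definition _ := @isSubBaseTopological.Build affine
  (set gword) setT (fun S => ~` zero_set S).

Lemma closed_zero_set S : closed (zero_set S).
Proof.
rewrite -openC; exists [set ~` zero_set S]; last by rewrite bigcup_set1.
by move=> _ ->; exact: (finI_from1 (fun S => ~` zero_set S)).
Qed.

Definition vanishing_set (Y : set affine) : set gword :=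
  [set f | forall a, Y a -> subst a f = 1].

Lemma subst1 (a : affine) : subst a 1 = 1.
Proof. exact: multiplicative1. Qed.

Lemma subst_const (a : affine) (g : G) : subst a (gincl gword_ggroup g) = g.
Proof. exact: freeprod_lift_inl. Qed.

Lemma substV (a : affine) s : subst a s^-1 = (subst a s)^-1.
Proof. by apply: (mulgI (subst a s)); rewrite -substM !mulgV subst1. Qed.

Section Coordinate.
Variable Y : set affine.

Lemma vanishing1 : vanishing_set Y 1.
Proof. by move=> a _; exact: subst1. Qed.

Lemma vanishingM x y :
  vanishing_set Y x -> vanishing_set Y y -> vanishing_set Y (x * y).
Proof. by move=> Yx Yy a Ya; rewrite substM Yx // Yy // mulg1. Qed.

Lemma vanishingV x : vanishing_set Y x -> vanishing_set Y x^-1.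
Proof. by move=> Yx a Ya; rewrite substV Yx // invg1. Qed.

Lemma vanishingJ x y : vanishing_set Y x -> vanishing_set Y (x ^ y).
Proof.
move=> Yx a Ya; rewrite conjgE !substM Yx // mul1g -substM mulVg.
exact: subst1.
Qed.

Definition vanishing : normal_subgroup gword :=
  NormalSubgroup vanishing1 vanishingM vanishingV vanishingJ.

Hypothesis Y0 : Y !=set0.

Lemma vanishing_cap : vanishing `&` range (gincl gword_ggroup) = [set 1].
Proof.
have [a Ya] := Y0; apply/seteqP; split => [x [Yx [g _ gx]]|_ ->] /=.
  have g1 : g = 1 by rewrite -(subst_const a g) gx; exact: Yx.
  by rewrite -gx g1; exact: multiplicative1.
by split; [exact: vanishing1 | exists 1 => //; exact: multiplicative1].
Qed.

Definition vanishing_ideal : ideal gword_ggroup :=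
  @Ideal G gword_ggroup vanishing vanishing_cap.

Definition coordinate_group : ggroup G := quotient_ggroup vanishing_ideal.

End Coordinate.

(* [Y] as a type carries the topology induced from [affine]. *)
Definition zariski_dim (Y : set affine) : \bar int :=
  topological_dim (set_type Y).

End Zariski.

Definition equationally_noetherian (G : groupType) : Prop :=
  forall (n : nat) (S : set (gword G n)), exists S0 : set (gword G n),
    [/\ finite_set S0, S0 `<=` S & zero_set S = zero_set S0].

(* Main.v *)
(** Points of [Y] are exactly the [G]-homomorphisms from the coordinate group
    to [G], and the closed sets of [Y] are generated by the zero sets of single
    elements of the coordinate group.  Irreducibility of [Z] says that [Z] lies
    in one member of any finite closed cover of it, so an irreducible set is the
    zero set of its ideal; discrimination of the quotient says the same thing
    about the elements outside the ideal.  Hence taking zeros and taking ideals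
    are mutually inverse order-reversing bijections between the non-empty
    irreducible closed subsets and the prime ideals, and chains correspond. *)

From HB Require Import structures.
Require Import Defs.
From mathcomp Require Import all_boot classical_sets.
From mathcomp Require Import finmap boolp cardinality.
From mathcomp Require Import topology_structure subtype_topology.

Set Implicit Arguments.
Unset Strict Implicit.
Unset Printing Implicit Defensive.

Local Open Scope classical_set_scope.
Local Open Scope quotient_scope.
Local Open Scope group_scope.

(** * Chains under order reversal, and finite covers of irreducible sets *)

(** The left inverse [E] makes [F] injective on [P], so strict inclusions stay strict; the chain is
    read backwards through [k - i]. *)
Lemma has_chain_rev (S T : Type) (P : set (set S)) (Q : set (set T))
    (F : set S -> set T) (E : set T -> set S) (k : nat) :
  (forall A, P A -> Q (F A)) -> {homo F : A B / A `<=` B >-> B `<=` A} ->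
  (forall A, P A -> E (F A) = A) ->
  has_chain P k -> has_chain Q k.
Proof.
move=> PQ Fanti EF [A [PA Alt]]; exists (fun i => F (A (k - i)%N)).
split=> [i _|i ik]; first by apply/PQ/PA/leq_subr.
have := Alt (k - i.+1)%N; rewrite -subSn // subSS => /(_ (leq_subr _ _)).
rewrite !properEneq => -[/eqP neqA subA]; split; last exact: Fanti.
apply/eqP=> eqF; apply: neqA.
by rewrite -[LHS](EF _ (PA _ (leq_subr _ _))) -eqF EF //; apply/PA/leq_subr.
Qed.

(** Induction on [s]: if [Z] lies neither in [C i] nor in the union [D] of the rest, its traces on
    them are proper closed subsets covering it. Non-emptiness excludes the empty list. *)
Lemma irreducible_sub_finite_cover (T : topologicalType) (I : choiceType)
    (C : I -> set T) (s : seq I) (Z : set T) :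
  (forall i, closed (C i)) -> irreducible_closed Z -> Z !=set0 ->
  (forall z, Z z -> exists2 i, i \in s & C i z) ->
  exists2 i, i \in s & Z `<=` C i.
Proof.
move=> Cc [Zc Zirr] [z0 Zz0].
elim: s => [|i s IHs] cover; first by have [] := cover _ Zz0.
have [ZCi|nZCi] := pselect (Z `<=` C i); first by exists i; rewrite ?mem_head.
pose D := \bigcup_(j in [set` s]) C j.
have Dc : closed D by apply: closed_bigcup (finite_seq s) _ => j _.
have [ZD|nZD] := pselect (Z `<=` D).
  have [j js ZCj] := IHs (fun z Zz => ZD z Zz).
  by exists j => //; rewrite inE js orbT.
case: Zirr; exists (Z `&` C i), (Z `&` D); split.
- exact: closedI.
- exact: closedI.
- by split=> [|ZZC]; [exact: subIsetl | case: nZCi => z /ZZC[]].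
- by split=> [|ZZD]; [exact: subIsetl | case: nZD => z /ZZD[]].
apply/seteqP; split=> [z Zz|z [[]|[]]//].
have [j] := cover z Zz; rewrite inE => /orP[/eqP->|js] Cz; first by left.
by right; split=> //; exists j.
Qed.

(** * Homomorphisms out of a quotient group *)

Section QuotientLift.
Variables (H K : groupType) (N : normal_subgroup H).
Variable f : {multiplicative H -> K}.
Hypothesis Nf : forall x, normal_set N x -> f x = 1.

(* The unused proof argument lets the morphism instance below be inferred. *)
Definition quotient_lift of (forall x, normal_set N x -> f x = 1) :=
  fun x : quotient_group N => f (repr x).

Lemma quotient_lift_pi x : quotient_lift Nf (quotient_proj N x) = f x.
Proof.
have /Nf : normal_set N (x^-1 * repr (quotient_proj N x)).
  by apply/quotient_piP; rewrite reprK.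
move=> fx; rewrite /quotient_lift -[in LHS](mulVKg x (repr _)).
by rewrite gmulfM fx mulg1.
Qed.

Lemma quotient_liftM : {morph quotient_lift Nf : x y / x * y}.
Proof.
have qK (z : quotient_group N) : quotient_proj N (repr z) = z by exact: reprK.
move=> x y; rewrite -[in LHS](qK x) -[in LHS](qK y) -gmulfM.
by rewrite quotient_lift_pi gmulfM.
Qed.

HB.instance Definition _ :=
  isMultiplicative.Build (quotient_group N) K (quotient_lift Nf) quotient_liftM.

End QuotientLift.

(** * Duality between irreducible closed sets and prime ideals *)

Section Duality.
Variables (G : groupType) (T : topologicalType) (H : ggroup G).
Variable ev : T -> {multiplicative H -> base_ggroup G}.

Definition zeros (p : set H) : set T := [set y | forall h, p h -> ev y h = 1].
Definition kernel (Z : set T) : set H := [set h | forall y, Z y -> ev y h = 1].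

Hypothesis ev_hom : forall y, is_ghom (ev y).
Hypothesis ev_surj : forall f : {multiplicative H -> base_ggroup G},
  is_ghom f -> exists y, ev y =1 f.
Hypothesis closed_ev : forall h, closed [set y | ev y h = 1].
(** Closed sets are intersections of finite unions of zero sets of single elements: one such union
    contains [Z] and misses [y]. *)
Hypothesis closed_sep : forall (Z : set T) y, closed Z -> ~ Z y ->
  exists2 s : seq H, (forall h, h \in s -> ev y h <> 1) &
    forall z, Z z -> exists2 h, h \in s & ev z h = 1.

Lemma closed_zeros (p : set H) : closed (zeros p).
Proof.
rewrite (_ : zeros p = \bigcap_(h in p) [set y | ev y h = 1]).
  exact: closed_bigI.
by apply/seteqP; split.
Qed.

(** In a finite cover of [Z] by zero sets missing [y], one member contains all of [Z]; its element
    lies in [kernel Z] but is nontrivial at [y]. *)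
Lemma zeros_kernel (Z : set T) :
  irreducible_closed Z -> Z !=set0 -> zeros (kernel Z) = Z.
Proof.
move=> Zirr Z0; apply/seteqP; split=> [y yZ|z Zz h]; last exact.
apply: contrapT => nZy; have [s sy sZ] := closed_sep Zirr.1 nZy.
have [h hs Zh] := irreducible_sub_finite_cover closed_ev Zirr Z0 sZ.
exact: sy hs (yZ _ Zh).
Qed.

Lemma kernel_prime (Z : set T) :
  irreducible_closed Z -> Z !=set0 -> is_prime (kernel Z).
Proof.
move=> Zirr Z0.
have K1 : kernel Z 1 by move=> y _; exact: multiplicative1.
have KM x y : kernel Z x -> kernel Z y -> kernel Z (x * y).
  by move=> Kx Ky z Zz; rewrite gmulfM Kx // Ky // mulg1.
have evV z x : ev z x^-1 = (ev z x)^-1.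
  by apply: (mulgI (ev z x)); rewrite -gmulfM !mulgV multiplicative1.
have KV x : kernel Z x -> kernel Z x^-1.
  by move=> Kx z Zz; rewrite evV Kx // invg1.
have KJ x y : kernel Z x -> kernel Z (x ^ y).
  by move=> Kx z Zz; rewrite conjgE !gmulfM Kx // evV mul1g mulVg.
pose N := NormalSubgroup K1 KM KV KJ.
have Ncap : N `&` range (gincl H) = [set 1].
  have [z Zz] := Z0; apply/seteqP; split=> [x [/= Kx [g _ gx]]|_ ->].
    have g1 : g = 1 by rewrite -[LHS](ev_hom z) gx Kx.
    by rewrite -gx g1; exact: multiplicative1.
  by split=> //; exists 1 => //; exact: multiplicative1.
exists (Ideal Ncap) => //= K /finite_seqP[s ->].
(* A point of [Z] where no element of [d] becomes trivial separates the cosets in [s], so evaluation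
   there discriminates them. *)
pose d := [seq ((repr u : H)^-1 * repr v) | u <- s, v <- [seq v <- s | v != u]].
have [[z Zz zd]|nd] :=
    pselect (exists2 z, Z z & forall h, h \in d -> ev z h <> 1); last first.
  (* Otherwise the zero sets of [d] cover [Z]; one of them contains [Z], which identifies two
     distinct cosets. *)
  have [|h] := @irreducible_sub_finite_cover _ _ _ d _ closed_ev Zirr Z0.
    move=> z Zz; apply: contrapT => zd; case: nd; exists z => // h hd h1.
    by apply: zd; exists h.
  move=> /allpairsPdep[u [v [us]]].
  rewrite mem_filter => /andP[/eqP vu vs] -> Zuv; case: vu.
  rewrite -[v]reprK -[u]reprK; apply/esym/quotient_piP; exact: Zuv.
have zN x : normal_set N x -> ev z x = 1 by exact.
exists (quotient_lift zN : {multiplicative _ -> _}) => [g|u v].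
  by rewrite /= quotient_lift_pi ev_hom.
move=> /set_mem/= us /set_mem/= vs uv; apply/eqP; apply: contrapT => /negP nuv.
apply: (zd ((repr u : H)^-1 * repr v)).
  by apply/allpairsPdep; exists u, v; rewrite mem_filter eq_sym nuv.
by rewrite gmulfM evV -[ev z (repr v)]uv mulVg.
Qed.

(** A discriminating homomorphism of the quotient, pulled back to [H], is evaluation at a point, and
    this point is a zero of [p]. *)
Lemma prime_separate (p : set H) (s : seq H) : is_prime p ->
  (forall h, h \in s -> ~ p h) ->
  exists2 y, zeros p y & forall h, h \in s -> ev y h <> 1.
Proof.
move=> [N <- Ndisc] sN.
(* With [1] in the list, injectivity keeps the nontrivial cosets away from [1]. *)
pose t := 1 :: [seq quotient_proj N h | h <- s].
have [f fhom finj] := Ndisc _ (finite_seq t).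
have [|y evf] := ev_surj (f := (f \o quotient_proj N)%FUN).
  by move=> g; exact: (fhom g).
exists y => [h Nh|h hs]; rewrite evf /=.
  suff -> : quotient_proj N h = 1 by exact: multiplicative1.
  by apply/esym/quotient_piP; rewrite invg1 mul1g.
move=> fh1; apply: (sN h hs).
have /quotient_piP : 1 = quotient_proj N h.
  apply: finj; last by rewrite /= [RHS]fh1; exact: multiplicative1.
    by apply/mem_set; rewrite /= mem_head.
  by apply/mem_set; rewrite /= inE map_f ?orbT.
by rewrite invg1 mul1g.
Qed.

Lemma kernel_zeros (p : set H) : is_prime p -> kernel (zeros p) = p.
Proof.
move=> pp; apply/seteqP; split=> [h hp|h ph y]; last exact.
apply: contrapT => nph; have [|y py] := @prime_separate p [:: h] pp.
  by move=> _ /[!inE] /eqP ->.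
by move=> /(_ h); rewrite mem_head => /(_ isT); apply; exact: hp.
Qed.

Lemma zeros_prime_neq0 (p : set H) : is_prime p -> zeros p !=set0.
Proof. by move=> /(@prime_separate p [::])[] // y py _; exists y. Qed.

(** Each proper closed subset is covered by the zero sets of finitely many elements outside [p]; a
    single zero of [p] avoids two such covers at once. *)
Lemma zeros_irreducible (p : set H) :
  is_prime p -> irreducible_closed (zeros p).
Proof.
move=> pp; split; first exact: closed_zeros.
have cover (A : set T) : closed A -> A `<` zeros p ->
    exists2 s : seq H, (forall h, h \in s -> ~ p h) &
      forall z, A z -> exists2 h, h \in s & ev z h = 1.
  move=> Ac [_ /existsNP[y /not_implyP[py nAy]]].
  have [s sy sA] := closed_sep Ac nAy.
  by exists s => // h hs ph; apply: (sy h hs); exact: py.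
move=> [A [B [Ac Bc /(cover _ Ac)[s sp sA] /(cover _ Bc)[t tp tB] pAB]]].
have [h|y + yst] := @prime_separate p (s ++ t) pp.
  by rewrite mem_cat => /orP[/sp|/tp].
by rewrite pAB => -[/sA|/tB] [h hst]; apply: yst; rewrite mem_cat hst ?orbT.
Qed.

Lemma dim_duality : topological_dim T = krull_dim H.
Proof.
rewrite /topological_dim /krull_dim /chain_dim.
suff -> : has_chain [set Z : set T | irreducible_closed Z /\ Z !=set0] =
          has_chain [set p : set H | is_prime p] by [].
apply/funext => k; apply/propext; split.
  apply: (@has_chain_rev _ _ _ _ kernel zeros) => [Z []|A B AB h Bh y /AB|Z []].
  - exact: kernel_prime.
  - exact: Bh.
  - exact: zeros_kernel.
apply: (@has_chain_rev _ _ _ _ zeros kernel) => [p pp|p q pq y qy h /pq|p].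
- by split; [exact: zeros_irreducible | exact: zeros_prime_neq0].
- exact: qy.
- exact: kernel_zeros.
Qed.

End Duality.

(** * The Zariski topology and the points of the coordinate group *)

(** A basic open neighbourhood of [a] off [Z] is a finite intersection of complements of zero sets;
    from each, one equation failing at [a] is kept. *)
Lemma closed_affine_sep (G : groupType) (n : nat) (Z : set (affine G n)) a :
  closed Z -> ~ Z a ->
  exists2 s : seq (gword G n), (forall f, f \in s -> subst a f <> 1) &
    forall z, Z z -> exists2 f, f \in s & subst z f = 1.
Proof.
rewrite -openC => -[D Dfin DZ] nZa.
have {}DZ : \bigcup_(B in D) B = ~` Z := DZ.
have [B DB Ba] : (\bigcup_(B in D) B) a by rewrite DZ.
have [F _ FB] := Dfin B DB.
have {}FB : \bigcap_(C in [set` F]) ~` zero_set C = B := FB.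
have wit C : C \in F -> exists2 f, C f & subst a f <> 1.
  move: Ba; rewrite -FB => /(_ C) + CF => /(_ CF) /existsNP[f /not_implyP[]].
  by exists f.
(* By [wit], the default [1] is never reached for [C] in [F]. *)
pose w C := xget 1 [set f | C f /\ subst a f <> 1].
have wP C : C \in F -> C (w C) /\ subst a (w C) <> 1.
  move=> /wit[f Cf fa].
  by apply: (@xgetPex _ 1 [set f | C f /\ subst a f <> 1]); exists f.
exists [seq w C | C <- F] => [_ /mapP[C CF ->]|z Zz]; first exact: (wP C CF).2.
apply: contrapT => nz; suff : (~` Z) z by [].
rewrite -DZ; exists B => //; rewrite -FB => C CF zS.
by apply: nz; exists (w C); [exact: map_f | exact/zS/(wP C CF).1].
Qed.

Section CoordinateEvaluation.
Variables (G : groupType) (n : nat) (Y : set (affine G n)) (Y0 : Y !=set0).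

Lemma subst_vanishing (y : set_type Y) (f : gword G n) :
  normal_set (vanishing_ideal Y0) f -> subst (val y) f = 1.
Proof. by apply; exact: set_valP. Qed.

Definition coordinate_eval (y : set_type Y) :
    {multiplicative coordinate_group Y0 -> base_ggroup G} :=
  quotient_lift (@subst_vanishing y).

Lemma coordinate_eval_pi y f :
  coordinate_eval y (quotient_proj (vanishing_ideal Y0) f) = subst (val y) f.
Proof. exact: quotient_lift_pi. Qed.

Lemma coordinate_eval_hom y : is_ghom (coordinate_eval y).
Proof.
move=> g; exact: etrans (coordinate_eval_pi _ _) (subst_const _ _).
Qed.

Lemma coordinate_eval_surj
    (f : {multiplicative coordinate_group Y0 -> base_ggroup G}) :
  algebraic Y -> is_ghom f -> exists y, coordinate_eval y =1 f.
Proof.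
move=> [S YS] fhom; pose pi := quotient_proj (vanishing_ideal Y0).
(* The coordinates are the images of the variables, so the universal properties identify [f \o pi]
   with substitution at [a]. The equations defining [Y] die in the coordinate group, hence hold at
   [a]. *)
pose a : affine G n := [ffun i => f (pi (freeprod_inr G (free_gen i)))].
have fa : (f \o pi)%FUN =1 subst a.
  apply: freeprod_lift_uniq => [g|x]; first exact: fhom.
  rewrite -[LHS]/(((f \o pi) \o @freeprod_inr G (freegroup 'I_n))%FUN x).
  by apply: free_lift_uniq => i; rewrite ffunE.
have Ya : Y a.
  rewrite YS => s Ss; rewrite -fa /=.
  suff -> : pi s = 1 by exact: multiplicative1.
  apply/esym/quotient_piP; rewrite invg1 mul1g => b.
  by rewrite YS => /(_ s Ss).
exists (exist _ a (mem_set Ya)) => x; rewrite -[x]reprK.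
by rewrite -[\pi _]/(pi _) coordinate_eval_pi -fa.
Qed.

Lemma closed_coordinate_eval h : closed [set y | coordinate_eval y h = 1].
Proof.
(* Evaluation of [h] is computed on a representative, so the set is the trace on [Y] of a zero
   set. *)
rewrite -openC; exists (~` zero_set [set (repr h : gword G n)]).
  by rewrite openC; exact: closed_zero_set.
apply/seteqP; split=> y ny yh; apply: ny; first by move=> _ ->.
exact: yh.
Qed.

(** A closed set of [Y] is the trace of a closed set of [affine G n]; the words separating there
    project to the coordinate group. *)
Lemma closed_coordinate_sep (Z : set (set_type Y)) y : closed Z -> ~ Z y ->
  exists2 s : seq (coordinate_group Y0),
    (forall h, h \in s -> coordinate_eval y h <> 1) &
    forall z, Z z -> exists2 h, h \in s & coordinate_eval z h = 1.
Proof.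
rewrite -openC => -[U Uo UZ] nZy.
have UZE z : U (val z) <-> ~ Z z by rewrite -[U _]/((_ @^-1` U) z) UZ.
have [||s sy sU] := @closed_affine_sep G n (~` U) (val y).
- by rewrite closedC.
- by apply; apply/UZE.
exists [seq quotient_proj (vanishing_ideal Y0) f | f <- s].
  by move=> _ /mapP[f fs ->]; rewrite coordinate_eval_pi; exact: sy.
move=> z Zz; have [|f fs zf] := sU (val z); first by move=> /UZE.
exists (quotient_proj (vanishing_ideal Y0) f); first exact: map_f.
by rewrite coordinate_eval_pi.
Qed.

End CoordinateEvaluation.

Theorem proposition3p2 (G : groupType) (hG : equationally_noetherian G)
    (n : nat) (Y : set (affine G n)) (Yalg : algebraic Y) (Y0 : Y !=set0) :
  zariski_dim Y = krull_dim (coordinate_group Y0).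
Proof.
apply: (@dim_duality _ _ _ (@coordinate_eval G n Y Y0)).
- exact: coordinate_eval_hom.
- by move=> f; exact: coordinate_eval_surj.
- exact: closed_coordinate_eval.
- exact: closed_coordinate_sep.
Qed.
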